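(* Let $(\bar p_{\bar i},\bar r_{\bar i})\in\mathcal{D}(p_i,r_i)$ and $(\bar p_{\bar j},\bar r_{\bar j})\in\mathcal{D}(p_j,r_j)$ be two fine-scale pivots in the relative pivot domains of coarse-scale pivots $(p_i,r_i)$ and $(p_j,r_j)$ respectively. If $(p_i,r_i)$ and $(p_j,r_j)$ do not share a GRNG link (with respect to the coarse-scale pivots $\mathcal{P}$), then $(\bar p_{\bar i},\bar r_{\bar i})$ and $(\bar p_{\bar j},\bar r_{\bar j})$ do not have a GRNG link (with respect to the fine-scale pivots $\bar{\mathcal{P}}$).
   Context: $(\mathcal{X},d)$ is a metric space. $\bar{\mathcal{P}}=\{(\bar p_{\bar i},\bar r_{\bar i})\}$ is a finite set of fine-scale pivots, i.e. points of $\mathcal{X}$ with radii $\bar r_{\bar i}\ge 0$, and $\mathcal{P}=\{(p_i,r_i)\}$ is a finite set of coarse-scale pivots with radii $r_i\ge 0$. Every coarse-scale pivot point is also (the point of) a fine-scale pivot, possibly with a different radius. Relative pivot domain: $\mathcal{D}(p_i,r_i)$ is the set of all fine-scale pivots $(\bar p_{\bar i},\bar r_{\bar i})$ with $d(p_i,\bar p_{\bar i})\le r_i-\bar r_{\bar i}$. Generalized lune: for points with radii $(a,r_a)$, $(b,r_b)$, the G-lune of $(a,r_a)$ and $(b,r_b)$ is the set of points $z$ with $d(z,a)<d(a,b)-(2r_a+r_b)$ and $d(z,b)<d(a,b)-(r_a+2r_b)$. Generalized Relative Neighborhood Graph (GRNG): two pivots of a given set of pivots have a GRNG link (with respect to that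 set) iff no pivot of that set lies in their G-lune, computed with their radii in that set. *)

(* Defs.v *)
From mathcomp Require Import all_boot all_order all_algebra.
From mathcomp Require Import all_classical all_reals.
From mathcomp Require Import topology.

Set Implicit Arguments.
Unset Strict Implicit.
Unset Printing Implicit Defensive.

Import Order.TTheory GRing.Theory Num.Theory.

Local Open Scope classical_set_scope.
Local Open Scope ring_scope.

(* A pivot is a pair (point, radius); as for any set of pairs,
   the same point may occur with several radii. *)
Definition pivot_set (R : realType) (X : metricType R) (P : set (X * R)) : Prop :=
  finite_set P /\ (forall a, P a -> 0 <= a.2).

Definition relative_domain (R : realType) (X : metricType R)
    (Pbar : set (X * R)) (a : X * R) : set (X * R) :=
  [set b | Pbar b /\ mdist a.1 b.1 <= a.2 - b.2].

Definition glune (R : realType) (X : metricType R) (a b : X * R) : set X :=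
  [set z | mdist z a.1 < mdist a.1 b.1 - (2 * a.2 + b.2) /\
           mdist z b.1 < mdist a.1 b.1 - (a.2 + 2 * b.2)].

(* Meant for pivots a, b of P. The lune is computed with the radii of a and b
   only; a third pivot matters only through its point. For a = b the lune is
   empty (nonnegative radii), so the link holds trivially. *)
Definition grng_link (R : realType) (X : metricType R)
    (P : set (X * R)) (a b : X * R) : Prop :=
  forall c, P c -> ~ glune a b c.1.

(* Main.v *)
(* The G-lune of two coarse pivots is contained in the G-lune of any two fine
   pivots of their domains. Since [d(a, a') <= r_a - r_a'], replacing [a] by [a']
   changes [d(a, b)] and [d(z, a)] by at most [r_a - r_a'], which the coefficients
   2 and 1 of the radii exactly absorb. A coarse pivot in the coarse lune is thus,
   as a point, a fine pivot in the fine lune. *)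
Require Import Defs.
From mathcomp Require Import all_boot all_order all_algebra.
From mathcomp Require Import all_classical all_reals.
From mathcomp Require Import topology.
From mathcomp Require Import lra.

Local Open Scope classical_set_scope.
Local Open Scope ring_scope.

Lemma glune_subset (R : realType) (X : metricType R) (a b a' b' : X * R) :
  mdist a.1 a'.1 <= a.2 - a'.2 -> mdist b.1 b'.1 <= b.2 - b'.2 ->
  glune a b `<=` glune a' b'.
Proof.
move=> haa' hbb' z [hza hzb].
have hza' := metric_triangle z a.1 a'.1.
have hzb' := metric_triangle z b.1 b'.1.
(* Path from [a] to [b] through [a'] and [b']: with the domain bounds, d(a, b) - r_a - r_b <= d(a',
   b') - r_a' - r_b'. Adding d(z, a') <= d(z, a) + r_a - r_a' leaves exactly 2 r_a' + r_b' to
   subtract; likewise for [b']. *)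
have hab := metric_triangle a.1 a'.1 b.1.
have ha'b := metric_triangle a'.1 b'.1 b.1.
rewrite [mdist b'.1 b.1]metric_sym in ha'b.
by split; lra.
Qed.

Theorem theorem2 (R : realType) (X : metricType R) (Pbar P : set (X * R))
    (hPbar : pivot_set Pbar) (hP : pivot_set P)
    (hsub : forall a, P a -> exists b, Pbar b /\ b.1 = a.1)
    (p_i p_j pbar_i pbar_j : X * R)
    (hi : P p_i) (hj : P p_j)
    (hbi : relative_domain Pbar p_i pbar_i)
    (hbj : relative_domain Pbar p_j pbar_j)
    (hnolink : ~ grng_link P p_i p_j) :
  ~ grng_link Pbar pbar_i pbar_j.
Proof.
move=> hlink; apply: hnolink => c hc hlune.
(* The fine pivot [b] at the point of [c] may have another radius, but membership in the fine lune
   concerns its point alone. *)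
have [b [hb hbc]] := hsub c hc.
apply: (hlink b hb); rewrite hbc.
by apply: glune_subset hlune; [case: hbi | case: hbj].
Qed.
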